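(* Let $A = \prod_{i=1}^m \mathbb Z/n_i$ be a product of finite cyclic groups with $n_i > 2$ for all $i$. If $\{H_1, \dots, H_{m'}\}$ is any hyperplane splitting of $A$ with union $\bigcup_{i=1}^{m'} H_i = \mathcal Z(A)$, then $m = m'$ and the $H_i$ are the coordinate hyperplanes of $A$ (that is, $\{H_1,\dots,H_{m'}\} = \{Z_1,\dots,Z_m\}$).
   Context: For $A = \prod_{i=1}^m \mathbb Z/n_i$, the $i$-th coordinate hyperplane is $Z_i = \{(x_1,\dots,x_m)\in A \mid x_i = 0\}$, and $\mathcal Z(A) = \bigcup_{i=1}^m Z_i$ is the set of elements with at least one coordinate equal to zero. A hyperplane in an abelian group $A$ is a subgroup $H \subset A$ with non-trivial cyclic quotient $A/H$. A hyperplane splitting of $A$ is an unordered collection $\{H_1,\dots,H_{m'}\}$ of hyperplanes of $A$ such that the natural map $A \to \prod_{i=1}^{m'} A/H_i$ is an isomorphism. *)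

(* Defs.v *)
From HB Require Import structures.
From mathcomp Require Import all_boot all_order all_algebra all_fingroup all_solvable.

Set Implicit Arguments.
Unset Strict Implicit.
Unset Printing Implicit Defensive.

Import GroupScope.

Section HyperplaneSplittings.

(* The ambient group is all of gT; the notions below are meant for abelian
   ambient groups, where every subgroup H is normal, so that [set: gT] / H is
   the whole type coset_of H. *)
Variable gT : finGroupType.

Definition hyperplane (H : {group gT}) : Prop :=
  cyclic ([set: gT] / H) /\ [set: gT] / H != 1.

Definition splitting_map (m : nat) (H : 'I_m -> {group gT}) (x : gT) :
    {dffun forall j : 'I_m, coset_of (H j)} :=
  [ffun j => coset (H j) x].

(* An unordered collection is represented by an arbitrary enumeration of it;
   neither this predicate nor the union depends on the order. Repetitions need
   not be excluded by hand: they contradict surjectivity of the natural map,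
   because the quotients are non-trivial. *)
Definition hyperplane_splitting (m : nat) (H : 'I_m -> {group gT}) : Prop :=
  (forall j, hyperplane (H j)) /\
  misom [set: gT] (setXn (fun j => [set: gT] / H j)) (splitting_map H).

End HyperplaneSplittings.

(* 'Z_k is Z/k only for k > 1. The finGroupType structure on 'Z_k is the
   additive one, and the product carries the componentwise operations. *)
Notation prodZ n := {dffun forall i, 'Z_(n i)}.

Definition coord_hyperplane (m : nat) (n : 'I_m -> nat) (i : 'I_m) :
    {set prodZ n} :=
  [set x : prodZ n | x i == 0%R].

Definition calZ (m : nat) (n : 'I_m -> nat) : {set prodZ n} :=
  \bigcup_(i < m) coord_hyperplane n i.

(* Main.v *)
Require Import Defs.
From HB Require Import structures.
From mathcomp Require Import all_boot all_order all_algebra all_fingroup all_solvable.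
From mathcomp Require Import zify.

(** The union of the hyperplanes of a splitting remembers more than it seems.
    View a splitting of A as an isomorphism F from A to a product of groups
    Q_i, so that its hyperplanes are the sets where a coordinate of F vanishes,
    and let supp x be the set of indices where x does not vanish. The
    complement U of the union is the set of elements of full support, and
    for every a the number of x such that both x and x a lie in U is the product
    over i of |Q_i| - 1 - [i \in supp a] ([overlap_weight]): in coordinate i one
    has to avoid 0 and the opposite of a_i. This number depends on U only, so
    two splittings F and G with the same union give equal products.

    Up to a common factor the product is that of the fractions
    (|Q_i| - 2) / (|Q_i| - 1) over i in supp a. As |Q_i| > 2 they are positive,
    less than 1, and increase with |Q_i|. Hence the largest value at a non-zero
    a is reached exactly on the axes (the elements supported at one index)
    of the largest factors, so F and G have the same elements on such axes.
    Multiplying by an element of an axis adds its index to a support that lacks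
    it, while a suitable element of the axis deletes the index from a support
    that has it; the product tells these apart, so that an axis determines the
    hyperplane opposite to it ([hyperplane_sub]). Downward induction on
    the order of the factors does the rest: once all factors of order larger
    than d have been matched, an axis element of G of order d vanishes on the
    matched hyperplanes, its support for F involves factors of order at most d
    only, and it is again extremal among these ([axis_transfer]).

    The comparison is between two decompositions of a finite group into products
    of finite groups; it is applied to the standard coordinates and to the
    natural map of the splitting. Distinct indices have distinct hyperplanes, so
    equality of the collections gives m = m'. *)

Set Implicit Arguments.
Unset Strict Implicit.
Unset Printing Implicit Defensive.

Import GroupScope.

(** * Strictly decreasing weights on finite sets *)

Section Weight.

Variables (I : finType) (n : I -> nat).
Implicit Types (S T : {set I}) (i : I).

(** For n_i the order of the i-th factor and S = supp a, this is the number of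
    elements x such that x and x a both have full support. *)
Definition weight S := (\prod_i (n i - 1 - (i \in S)))%N.

Lemma weight_setU1 i S : i \notin S ->
  (weight (i |: S) * (n i - 1) = weight S * (n i - 2))%N.
Proof.
move=> iS; rewrite /weight !(bigD1 (P := predT) i) //= setU11 (negbTE iS) subn0.
rewrite (eq_bigr (fun k => (n k - 1 - (k \in S))%N)); first by lia.
by move=> k ki; rewrite !inE (negbTE ki).
Qed.

Hypothesis n_gt2 : forall i, (2 < n i)%N.

Lemma weight_gt0 S : (0 < weight S)%N.
Proof.
by apply: prodn_gt0 => i; have := n_gt2 i; case: (i \in S) => /=; lia.
Qed.

Lemma weight_subset S T : S \subset T -> (weight T <= weight S)%N.
Proof.
move/subsetP=> ST; apply: leq_prod => i _; apply: leq_sub2l.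
by case: (boolP (i \in S)) => // /ST ->.
Qed.

Lemma weight_proper S T : S \proper T -> (weight T < weight S)%N.
Proof.
case/properP=> ST [i iT iS].
have iST : i |: S \subset T by rewrite subUset sub1set iT.
apply: leq_ltn_trans (weight_subset iST) _.
have := weight_setU1 iS; have := weight_gt0 S; have := n_gt2 i; nia.
Qed.

(** A set containing an index of value at most d has weight at most
    (d - 2) / (d - 1) times that of the empty set, and this lemma is the case of
    equality: a smaller value of n i or a second index would make the weight
    strictly smaller. *)
Lemma weight_rigid S i d : (2 < d)%N -> i \in S -> (n i <= d)%N ->
  (weight S * (d - 1) = weight set0 * (d - 2))%N -> S = [set i] /\ n i = d.
Proof.
move=> d_gt2 iS n_le_d wS.
have wi : (weight [set i] * (n i - 1) = weight set0 * (n i - 2))%N.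
  by rewrite -(weight_setU1 (S := set0)) ?inE // setU0.
have iS' : [set i] \subset S by rewrite sub1set.
have w0 := weight_gt0 set0; have n2 := n_gt2 i.
have nd : n i = d.
  (* The fraction (n i - 2) / (n i - 1) is at least (d - 2) / (d - 1), because
     the weight of S is at most that of its subset [set i]. *)
  have : (weight set0 * ((d - 2) * (n i - 1)) <=
          weight set0 * ((n i - 2) * (d - 1)))%N.
    by rewrite !mulnA -wi -wS mulnAC leq_mul2r leq_mul2r (weight_subset iS') !orbT.
  by rewrite leq_pmul2l //; nia.
split=> //; apply/eqP; rewrite eq_sym eqEproper iS'; apply/negP=> /weight_proper.
by move: wi; rewrite nd -wS => /eqP; rewrite eqn_pmul2r; [move/eqP-> | ]; lia.
Qed.

End Weight.

(** * Supports and overlaps in a product decomposition *)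

Section Coordinates.

Variables (gT : finGroupType) (I : finType) (Q : I -> finGroupType).
Variable F : gT -> {dffun forall i, Q i}.
Implicit Types (i : I) (x y : gT).

Definition coordinates := {morph F : x y / x * y} /\ bijective F.

Definition supp x := [set i | F x i != 1].

Definition full_supp := [set x | supp x == setT].

Definition order_at i := #|Q i|.

Lemma full_suppE : full_supp = ~: \bigcup_i [set x | i \notin supp x].
Proof.
apply/setP=> x; rewrite !inE; apply/eqP/idP=> [sx|/bigcupP sx].
  by apply/bigcupP=> -[i _]; rewrite inE sx inE.
apply/setP=> i; rewrite in_setT; apply/negPn/negP=> ix.
by apply: sx; exists i => //; rewrite in_set; exact: ix.
Qed.

Hypothesis coordF : coordinates.

Lemma coord1 : F 1 = 1.
Proof. by apply: (mulgI (F 1)); rewrite -coordF.1 !mulg1. Qed.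

Lemma supp1 : supp 1 = set0.
Proof. by apply/setP=> i; rewrite !inE coord1 oneg_ffun eqxx. Qed.

Lemma supp_eq0 x : (supp x == set0) = (x == 1).
Proof.
apply/eqP/eqP=> [sx|->]; last exact: supp1.
apply: (bij_inj coordF.2); rewrite coord1; apply/ffunP=> i.
by have /setP/(_ i) := sx; rewrite !inE oneg_ffun => /negbFE/eqP.
Qed.

Lemma mem_suppMl x y i : i \notin supp x -> (i \in supp (x * y)) = (i \in supp y).
Proof.
by rewrite !inE negbK => /eqP Fx; rewrite coordF.1 mulg_ffun Fx mul1g.
Qed.

Lemma mem_suppMr x y i : i \notin supp y -> (i \in supp (x * y)) = (i \in supp x).
Proof.
by rewrite !inE negbK => /eqP Fy; rewrite coordF.1 mulg_ffun Fy mulg1.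
Qed.

Lemma ex_axis i (q : Q i) : q != 1 -> exists2 x, F x i = q & supp x = [set i].
Proof.
have [G _ GK] := coordF.2; move=> q1.
exists (G (dfung1 q)); rewrite ?GK ?dfung1_id //.
apply/setP=> k; rewrite !inE GK; have [->|ki] := eqVneq k i.
  by rewrite dfung1_id q1.
by rewrite dfung1_dflt ?eqxx // eq_sym.
Qed.

Lemma ex_axis_gt1 i : (1 < order_at i)%N -> exists x, supp x = [set i].
Proof.
rewrite /order_at -cardsT => /card_gt1P[p [q [_ _ pq]]].
have [p1|/ex_axis[x _ sx]] := eqVneq p 1; last by exists x.
have /ex_axis[x _ sx] : q != 1 by rewrite eq_sym -p1.
by exists x.
Qed.

(** The left-hand side depends on F only through its elements of full support;
    this is what makes two decompositions comparable. In coordinate i, the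
    element x has to avoid 1 and (F a i)^-1, which coincide when i is not in the
    support of a. *)
Lemma overlap_weight a :
  #|[set x in full_supp | x * a \in full_supp]| = weight order_at (supp a).
Proof.
pose B i := ~: [set 1; (F a i)^-1].
have -> : [set x in full_supp | x * a \in full_supp] = F @^-1: setXn B.
  have inB x i : (F x i \in B i) = (F x i != 1) && (F (x * a) i != 1).
    by rewrite !inE negb_or eq_mulgV1 invg1 mulg1 coordF.1 mulg_ffun
               [F x i == _^-1]eq_mulgV1 invgK.
  apply/setP=> x; rewrite !inE; apply/andP/forallP=> [[/eqP sx /eqP sxa] i|sx].
    by move: (in_setT i) (in_setT i); rewrite -{1}sx -sxa inB !inE => -> ->.
  by split; apply/eqP/setP=> i; have := sx i; rewrite inB !inE => /andP[].
rewrite on_card_preimset; last by apply: onW_bij; exact: coordF.2.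
rewrite cardsXn; apply: eq_bigr => i _; rewrite cardsCs setCK cards2 -/(order_at i).
by rewrite inE eq_sym invg_eq1; case: eqP => /=; lia.
Qed.

End Coordinates.

(** * Comparing two decompositions with the same elements of full support *)

Section Comparison.

Variables (gT : finGroupType) (I J : finType).
Variables (Q : I -> finGroupType) (R : J -> finGroupType).
Variables (F : gT -> {dffun forall i, Q i}) (G : gT -> {dffun forall j, R j}).
Hypotheses (coordF : coordinates F) (coordG : coordinates G).
Hypothesis eq_full : full_supp F = full_supp G.
Hypothesis Q_gt2 : forall i, (2 < order_at Q i)%N.

Lemma eq_weight a :
  weight (order_at Q) (supp F a) = weight (order_at R) (supp G a).
Proof. by rewrite -!overlap_weight // eq_full. Qed.

(** A factor of order at most 2 would make some overlap empty, which cannot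
    happen for F. *)
Lemma order_gt2_transfer j : (2 < order_at R j)%N.
Proof.
have factor_gt0 a : (0 < order_at R j - 1 - (j \in supp G a))%N.
  have := weight_gt0 Q_gt2 (supp F a); rewrite eq_weight /weight.
  by rewrite (bigD1 j) //= muln_gt0 => /andP[].
have /(ex_axis_gt1 coordG)[a sa] : (1 < order_at R j)%N.
  by have := factor_gt0 1; lia.
by have := factor_gt0 a; rewrite sa set11 /=; lia.
Qed.

(** The invariant of the downward induction on d: the hyperplanes of F with
    quotient of order at least d are also hyperplanes of G. The orders of
    the quotients have to be kept, since the induction is on them. *)
Definition matched d := forall i, (d <= order_at Q i)%N ->
  exists2 j, order_at R j = order_at Q i
           & forall x, (i \in supp F x) = (j \in supp G x).

(** The support of a for F avoids every factor of order larger than d: such a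
    factor is matched with one of G of the same order, which is not the factor j,
    so a vanishes there. The weight of a then forces its support for F to be
    a singleton. *)
Lemma axis_transfer d a j : matched d.+1 ->
    supp G a = [set j] -> order_at R j = d ->
  exists2 i, supp F a = [set i] & order_at Q i = d.
Proof.
move=> mFG sa rj.
have d_gt2 : (2 < d)%N by rewrite -rj order_gt2_transfer.
have le_d i : i \in supp F a -> (order_at Q i <= d)%N.
  rewrite leqNgt => ia; apply/negP=> lt_d; have [k rk /(_ a)] := mFG i lt_d.
  rewrite ia sa inE => /esym/eqP kj.
  by move: lt_d; rewrite -rk kj rj ltnn.
have wa : (weight (order_at Q) (supp F a) * (d - 1) =
           weight (order_at Q) set0 * (d - 2))%N.
  have w0 : weight (order_at Q) set0 = weight (order_at R) set0.
    by have := eq_weight 1; rewrite !supp1.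
  by rewrite w0 eq_weight sa -rj -(@weight_setU1 _ _ j set0) ?inE // setU0.
have /set0Pn[i ia] : supp F a != set0.
  rewrite supp_eq0 // -(supp_eq0 coordG) sa.
  by apply/set0Pn; exists j; rewrite set11.
by exists i; have [] := weight_rigid Q_gt2 d_gt2 ia (le_d i ia) wa.
Qed.

(** The index i supporting a must serve for the whole axis j: if b lay on a
    different axis k of F, then a b would have support {i, k} for F, although it
    is a non-trivial element of the axis j of G, hence on an axis of F. *)
Lemma axis_rigid d a i j : matched d.+1 ->
    supp F a = [set i] -> supp G a = [set j] -> order_at R j = d ->
  forall b, supp G b = [set j] -> supp F b = [set i].
Proof.
move=> mFG Fa Ga rj b Gb.
have [k Fb _] := axis_transfer mFG Gb rj; rewrite Fb.
have [-> //|ki] := eqVneq k i.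
have ia : i \in supp F (a * b).
  by rewrite mem_suppMr // ?Fa ?Fb ?inE // eq_sym.
have kab : k \in supp F (a * b) by rewrite mem_suppMl // ?Fa ?Fb ?inE.
have Gab : supp G (a * b) = [set j].
  apply/eqP; rewrite eqEsubset sub1set; apply/andP; split.
    apply/subsetP=> l; apply: contraLR => lj.
    by rewrite mem_suppMl // ?Ga // Gb.
  apply: contraLR ia => jab.
  suff /eqP -> : supp F (a * b) == set0 by rewrite inE.
  rewrite supp_eq0 // -(supp_eq0 coordG); apply/eqP/setP=> l; rewrite in_set0.
  have [->|lj] := eqVneq l j; first exact/negbTE.
  by rewrite mem_suppMl // ?Ga ?Gb inE (negbTE lj).
have [l Fab _] := axis_transfer mFG Gab rj.
by move: ia kab ki; rewrite Fab !inE => /eqP <- ->.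
Qed.

(** If j were in the support of x for G but i not in that for F, multiplying x
    by the axis element b that cancels its j-th coordinate would delete j from
    the former support and add i to the latter: the weight would both increase
    and decrease. *)
Lemma hyperplane_sub i j :
    (forall b, supp G b = [set j] -> supp F b = [set i]) ->
  forall x, j \in supp G x -> i \in supp F x.
Proof.
move=> axes x jx; apply: contraLR (jx) => ix; exfalso.
have [|b Gbj Gb] := ex_axis coordG (q := (G x j)^-1).
  by rewrite invg_eq1; rewrite inE in jx.
have Fb := axes b Gb.
have Fxb : supp F (x * b) = i |: supp F x.
  apply/setP=> k; rewrite in_setU1; have [->|ki] := eqVneq k i.
    by rewrite mem_suppMl // Fb set11.
  by rewrite mem_suppMr // Fb inE.
have jxb : j \notin supp G (x * b).
  by rewrite inE coordG.1 mulg_ffun Gbj mulgV eqxx.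
have Gxb : supp G x = j |: supp G (x * b).
  apply/setP=> k; rewrite in_setU1; have [->//|kj] := eqVneq k j.
  by rewrite mem_suppMr // Gb inE.
have lt_F : (weight (order_at Q) (supp F (x * b)) <
             weight (order_at Q) (supp F x))%N.
  by apply: (weight_proper Q_gt2); rewrite Fxb properUr // sub1set.
have : (weight (order_at R) (supp G x) <
        weight (order_at R) (supp G (x * b)))%N.
  apply: (weight_proper order_gt2_transfer).
  by rewrite Gxb properUr // sub1set.
by rewrite -!eq_weight => /(ltn_trans lt_F); rewrite ltnn.
Qed.

End Comparison.

(** * Hyperplanes are determined by their union *)

Section Matching.

Variables (gT : finGroupType) (I J : finType).
Variables (Q : I -> finGroupType) (R : J -> finGroupType).
Variables (F : gT -> {dffun forall i, Q i}) (G : gT -> {dffun forall j, R j}).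
Hypotheses (coordF : coordinates F) (coordG : coordinates G).
Hypothesis eq_full : full_supp F = full_supp G.
Hypothesis Q_gt2 : forall i, (2 < order_at Q i)%N.
Hypothesis R_gt2 : forall j, (2 < order_at R j)%N.

Lemma matched_step d : matched F G d.+1 -> matched G F d.+1 -> matched F G d.
Proof.
move=> mFG mGF i; rewrite leq_eqVlt => /predU1P[qi|]; last exact: mFG.
have [a Fa] := ex_axis_gt1 coordF (ltnW (Q_gt2 i)).
have [j Ga rj] := axis_transfer coordG coordF (esym eq_full) R_gt2 mGF Fa (esym qi).
exists j => [|x]; first by rewrite rj.
apply/idP/idP.
  apply: (hyperplane_sub coordG coordF (esym eq_full) R_gt2).
  exact: (axis_rigid coordG coordF (esym eq_full) R_gt2 mGF Ga Fa).
apply: (hyperplane_sub coordF coordG eq_full Q_gt2).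
exact: (axis_rigid coordF coordG eq_full Q_gt2 mFG Fa Ga).
Qed.

End Matching.

Section MatchingTheorem.

Variables (gT : finGroupType) (I J : finType).
Variables (Q : I -> finGroupType) (R : J -> finGroupType).
Variables (F : gT -> {dffun forall i, Q i}) (G : gT -> {dffun forall j, R j}).
Hypotheses (coordF : coordinates F) (coordG : coordinates G).
Hypothesis eq_full : full_supp F = full_supp G.
Hypothesis Q_gt2 : forall i, (2 < order_at Q i)%N.

Let R_gt2 := order_gt2_transfer coordF coordG eq_full Q_gt2.

Lemma all_matched d : matched F G d /\ matched G F d.
Proof.
pose M := (\max_i order_at Q i + \max_j order_at R j).+1.
have [n le_M] : exists n, (M <= d + n)%N by exists M; apply: leq_addl.
elim: n d le_M => [|n IHn] d.
  (* No factor has order at least M, so both claims hold vacuously. *)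
  rewrite addn0 => le_M; split=> k le_d; have := leq_trans le_M le_d.
    by rewrite ltnNge (leq_trans (leq_bigmax k)) ?leq_addr.
  by rewrite ltnNge (leq_trans (leq_bigmax k)) ?leq_addl.
rewrite addnS -addSn => /IHn[mFG mGF].
by split; apply: matched_step.
Qed.

Lemma coordinate_hyperplanes_unique :
  [set [set x | i \notin supp F x] | i : I] =
  [set [set x | j \notin supp G x] | j : J].
Proof.
have [mFG mGF] := all_matched 0.
apply/setP=> Z; apply/imsetP/imsetP=> -[i _ ->].
  have [j _ eq_ij] := mFG i isT; exists j => //.
  by apply/setP=> x; rewrite !inE; have := eq_ij x; rewrite !inE => ->.
have [j _ eq_ij] := mGF i isT; exists j => //.
by apply/setP=> x; rewrite !inE; have := eq_ij x; rewrite !inE => ->.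
Qed.

End MatchingTheorem.

Lemma coordinate_hyperplane_inj (gT : finGroupType) (I : finType)
    (Q : I -> finGroupType) (F : gT -> {dffun forall i, Q i}) :
    coordinates F -> (forall i, (1 < order_at Q i)%N) ->
  injective (fun i => [set x | i \notin supp F x]).
Proof.
move=> coordF Q_gt1 i k /= /setP eq_ik; apply/eqP.
have [a Fa] := ex_axis_gt1 coordF (Q_gt1 i).
have := eq_ik a; rewrite [LHS]inE [RHS]inE Fa !inE eqxx.
by rewrite eq_sym => /esym/negbFE.
Qed.

(** * Hyperplane splittings as decompositions *)

Lemma prodZ_abelian (m : nat) (n : 'I_m -> nat) : abelian [set: prodZ n].
Proof.
apply/centsP=> x _ y _; apply/ffunP=> i; rewrite !mulg_ffun.
exact: Zp_mulgC.
Qed.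

Lemma splitting_coordinates (gT : finGroupType) (m : nat)
    (H : 'I_m -> {group gT}) :
  hyperplane_splitting H -> coordinates (splitting_map H).
Proof.
move=> [_ /misomP[fM /isomP[/injmP inj im]]]; split.
  by move=> x y; apply: (morphicP fM); rewrite inE.
have inj_s : injective (splitting_map H).
  by move=> x y; apply: inj; rewrite inE.
apply: inj_card_bij => //.
have full_image : setXn (fun j => [set: gT] / H j) =
                  [set: {dffun forall j, coset_of (H j)}].
  by apply/setP=> z; rewrite in_setT; apply/setXnP=> j; rewrite quotientT in_setT.
rewrite -[leqLHS]cardsT -full_image -im morphimEdom -[leqRHS]cardsT.
exact: leq_imset_card.
Qed.

(** Commutativity puts x in the normaliser of H j; off the normaliser, coset
    takes the value 1 by convention. *)
Lemma supp_splitting_map (gT : finGroupType) (m : nat) (H : 'I_m -> {group gT})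
    (x : gT) j : abelian [set: gT] ->
  (j \in supp (splitting_map H) x) = (x \notin H j).
Proof.
move=> abG; rewrite inE ffunE; congr (~~ _).
have nHx : x \in 'N(H j).
  by rewrite (subsetP (sub_abelian_norm abG (subsetT _))) ?inE.
by apply/eqP/idP=> [|xH]; [apply: coset_idr | apply: coset_id].
Qed.

Theorem theorem1 (m : nat) (n : 'I_m -> nat) (hn : forall i : 'I_m, 2 < n i)
    (m' : nat) (H : 'I_m' -> {group prodZ n})
    (Hsplit : hyperplane_splitting H)
    (Hunion : \bigcup_(j < m') (H j : {set prodZ n}) = calZ n) :
  m = m' /\
  [set (H j : {set prodZ n}) | j : 'I_m'] =
    [set coord_hyperplane n i | i : 'I_m].
Proof.
(* The standard coordinates are the identity map of the product. *)
pose F (x : prodZ n) := x; pose G := splitting_map H.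
have abA := prodZ_abelian n.
have coordF : coordinates F by split=> //; exists id.
have coordG : coordinates G := splitting_coordinates Hsplit.
have ZE i : coord_hyperplane n i = [set x | i \notin supp F x].
  by apply/setP=> x; rewrite !inE negbK.
have HE j : H j = [set x | j \notin supp G x] :> {set prodZ n}.
  by apply/setP=> x; rewrite inE supp_splitting_map // negbK.
have eq_full : full_supp F = full_supp G.
  rewrite !full_suppE -(eq_bigr _ (fun i _ => ZE i)) -(eq_bigr _ (fun j _ => HE j)).
  by rewrite Hunion.
have Q_gt2 i : (2 < order_at (fun i => 'Z_(n i)) i)%N.
  by rewrite /order_at card_ord; have := hn i; case: (n i) => [|[|[]]].
have Q_gt1 i := ltnW (Q_gt2 i).
have R_gt1 j := ltnW (order_gt2_transfer coordF coordG eq_full Q_gt2 j).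
have eq_HZ : [set (H j : {set prodZ n}) | j : 'I_m'] =
             [set coord_hyperplane n i | i : 'I_m].
  rewrite (eq_imset _ HE) (eq_imset _ ZE).
  exact/esym/(coordinate_hyperplanes_unique coordF coordG).
split=> //.
have injZ := coordinate_hyperplane_inj coordF Q_gt1.
have injH := coordinate_hyperplane_inj coordG R_gt1.
rewrite -[m]card_ord -[m']card_ord -(card_imset _ injZ) -(card_imset _ injH).
by rewrite -(eq_imset _ ZE) -(eq_imset _ HE) eq_HZ.
Qed.
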